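(* There is a constant $C>0$ (depending only on $p$) such that for all strictly positive supersolutions $u$ of $Q'[\varphi]=0$ on $X$ and for all $\varphi\in C_c(X)$, $$Q(0\vee\varphi\wedge u)\le C\,Q(\varphi).$$
   Context: Setting: $p\in(1,\infty)$; $X$ is an infinite countable set with the discrete topology. $m:X\to(0,\infty)$ is a measure of full support. $C(X)$ is the set of all functions $X\to\mathbb{R}$ and $C_c(X)$ the set of finitely supported ones. $b:X\times X\to[0,\infty)$ is a connected graph over $(X,m)$: symmetric, zero diagonal, $\sum_{y}b(x,y)<\infty$ for all $x$, and any two vertices are joined by a finite path along which $b>0$. $c:X\to\mathbb{R}$ is a potential. Write $\nabla_{xy}f=f(x)-f(y)$, $\vee=\max$, $\wedge=\min$. The energy functional is $$Q(\varphi)=\tfrac12\sum_{x,y\in X}b(x,y)|\nabla_{xy}\varphi|^p+\sum_{x\in X}c(x)|\varphi(x)|^p,\quad \varphi\in C_c(X),$$ and it is assumed that $Q\ge0$ on $C_c(X)$. Let $\mathcal F(X)=\{f\in C(X): \sum_y b(x,y)|\nabla_{xy}f|^{p-1}<\infty \text{ for all }x\}$ and, for $f\in\mathcal F(X)$, $$Q'[f](x)=\frac1{m(x)}\sum_{y}b(x,y)|\nabla_{xy}f|^{p-2}\nabla_{xy}f+\frac{c(x)}{m(x)}|f(x)|^{p-2}f(x)$$ (with $|0|^{p-2}0=0$). A function $u\in\mathcal F(X)$ is a supersolution on $X$ if $Q'[u]\ge0$ on $X$; strictly positive means $u>0$ everywhere. By the paper's convention, $C$ denotes a constant depending only on $p$.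 *)

(* Defs.v *)
From mathcomp Require Import all_boot all_order all_algebra.
From mathcomp Require Import all_classical all_reals all_analysis.

Set Implicit Arguments.
Unset Strict Implicit.
Unset Printing Implicit Defensive.

Import Order.TTheory GRing.Theory Num.Theory.

Local Open Scope classical_set_scope.
Local Open Scope ring_scope.

Definition finitely_supported (R : realType) (X : countType) (f : X -> R) : Prop :=
  finite_set [set x | f x != 0].

Record connected_graph (R : realType) (X : countType) (b : X -> X -> R) : Prop := {
  graph_ge0 : forall x y, 0 <= b x y ;
  graph_sym : forall x y, b x y = b y x ;
  graph_diag : forall x, b x x = 0 ;
  graph_summable : forall x, (\esum_(y in [set: X]) (b x y)%:E < +oo)%E ;
  graph_connected : forall x y, exists s : seq X,
    path (fun v w => 0 < b v w) x s /\ last x s = y }.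

(* The energy takes values in [\bar R] because its first term is a sum of
   nonnegative reals over an infinite set; it is finite for finitely supported
   [phi].  The second sum ranges over the support of its summand, which is
   finite for such [phi] since 0 `^ p = 0 (p != 0). *)
Definition energy (R : realType) (X : countType) (p : R) (b : X -> X -> R)
    (c : X -> R) (phi : X -> R) : \bar R :=
  ((2^-1)%:E * (\esum_(xy in [set: X * X])
      (b xy.1 xy.2 * `|phi xy.1 - phi xy.2| `^ p)%:E)
   + (\sum_(x \in [set: X]) c x * `|phi x| `^ p)%:E)%E.

(* The formal space F(X). *)
Definition formal_domain (R : realType) (X : countType) (p : R)
    (b : X -> X -> R) (f : X -> R) : Prop :=
  forall x,
    (\esum_(y in [set: X]) (b x y * `|f x - f y| `^ (p - 1))%:E < +oo)%E.

(* The sum of an absolutely summable real family: the sum of the positive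
   parts minus the sum of the negative parts (a junk value otherwise). *)
Definition abs_sum (R : realType) (X : countType) (a : X -> R) : R :=
  fine (\esum_(y in [set: X]) (Num.max (a y) 0)%:E)%E
  - fine (\esum_(y in [set: X]) (Num.max (- a y) 0)%:E)%E.

(* |t|^(p-2) t, equal to 0 at t = 0 for every p. *)
Definition signed_pow (R : realType) (p t : R) : R := `|t| `^ (p - 2) * t.

(* The operator Q'; its sum converges absolutely for [f] in [formal_domain]. *)
Definition schroedinger (R : realType) (X : countType) (p : R) (m : X -> R)
    (b : X -> X -> R) (c : X -> R) (f : X -> R) (x : X) : R :=
  (m x)^-1 * abs_sum (fun y => b x y * signed_pow p (f x - f y))
  + c x / m x * signed_pow p (f x).

Definition supersolution (R : realType) (X : countType) (p : R) (m : X -> R)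
    (b : X -> X -> R) (c : X -> R) (u : X -> R) : Prop :=
  formal_domain p b u /\ forall x, 0 <= schroedinger p m b c u x.

(* Main.v *)
(* The inequality holds with C = 1.  Put psi = 0 \/ phi /\ u and
   w = (|phi|^p - |psi|^p) / u^(p-1), which is nonnegative and finitely
   supported.  Testing Q'[u] >= 0 against m w and symmetrizing gives
     1/2 sum b |D u|^(p-2) D u D w + sum c (|phi|^p - |psi|^p) >= 0,
   while on every edge |D psi|^p + |D u|^(p-2) D u D w <= |D phi|^p.
   Passing from phi to 0 \/ phi and then to (0 \/ phi) /\ u, every case of the
   edge inequality follows from the superadditivity of t^p or from Picone's
   inequality, which expresses the convexity of the perspective x^p / s^(p-1). *)
Require Import Defs.
From mathcomp Require Import all_boot all_order all_algebra.
From mathcomp Require Import all_classical all_reals all_analysis.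
From mathcomp Require Import ring lra.

Set Implicit Arguments.
Unset Strict Implicit.
Unset Printing Implicit Defensive.

Import Order.TTheory GRing.Theory Num.Theory.

Local Open Scope classical_set_scope.
Local Open Scope ring_scope.

(** * The signed power: oddness, monotonicity and size *)

Lemma signed_pow0 (R : realType) (p : R) : signed_pow p 0 = 0.
Proof. by rewrite /signed_pow mulr0. Qed.

Lemma signed_powN (R : realType) (p t : R) : signed_pow p (- t) = - signed_pow p t.
Proof. by rewrite /signed_pow normrN mulrN. Qed.

Lemma signed_pow_gt0E (R : realType) (p t : R) :
  0 < t -> signed_pow p t = t `^ (p - 1).
Proof.
move=> t0; rewrite /signed_pow gtr0_norm// -{2}(powRr1 (ltW t0)) -powRD.
  by congr powR; ring.
by rewrite (gt_eqF t0) implybT.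
Qed.

Lemma signed_pow_le (R : realType) (p : R) : 1 < p ->
  {homo signed_pow p : s t / s <= t}.
Proof.
move=> p1.
have mono s t : 0 < s -> s <= t -> signed_pow p s <= signed_pow p t.
  move=> s0 st; rewrite !signed_pow_gt0E//; last exact: lt_le_trans st.
  by rewrite ge0_ler_powR ?nnegrE//; lra.
have ge0 t : 0 <= t -> 0 <= signed_pow p t.
  by move=> t0; rewrite mulr_ge0 ?powR_ge0.
move=> s t st; have [s0|s0|s0] := ltgtP s 0; last by rewrite s0 signed_pow0 ge0 -?s0.
- have [t0|t0] := leP 0 t.
    apply: (@le_trans _ _ 0); last exact: ge0.
    by rewrite -oppr_ge0 -signed_powN ge0//; lra.
  by rewrite -lerN2 -!signed_powN mono//; lra.
- exact: mono.
Qed.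

Lemma norm_signed_pow (R : realType) (p t : R) : 1 < p ->
  `|signed_pow p t| = `|t| `^ (p - 1).
Proof.
move=> p1; have [t0|t0|->] := ltgtP t 0.
- by rewrite -normrN -signed_powN signed_pow_gt0E ?oppr_gt0// ger0_norm
    ?powR_ge0// ltr0_norm.
- by rewrite signed_pow_gt0E// ger0_norm ?powR_ge0// gtr0_norm.
- by rewrite signed_pow0 normr0 powR0//; lra.
Qed.

Lemma signed_powM (R : realType) (p t : R) : 1 < p ->
  signed_pow p t * t = `|t| `^ p.
Proof.
move=> p1; rewrite -mulr_powRB1//; last lra.
rewrite -norm_signed_pow// mulrC -normrM ger0_norm//.
by rewrite /signed_pow mulrCA mulr_ge0 ?powR_ge0// -expr2 sqr_ge0.
Qed.

(** * Superadditivity, perspective convexity and Picone's inequality *)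

Lemma powR_superadd (R : realType) (p x y : R) : 1 <= p -> 0 <= x -> 0 <= y ->
  x `^ p + y `^ p <= (x + y) `^ p.
Proof.
move=> p1 x0 y0; have p0 : 0 < p by lra.
(* Each power splits as [z * z]^ (p - 1)[; both factors]x [^ (p - 1)] and [y]^ (p -
   1)[are then bounded by](x + y) [^ (p - 1)]. *)
rewrite -(mulr_powRB1 x0 p0) -(mulr_powRB1 y0 p0) -(mulr_powRB1 (addr_ge0 x0 y0) p0).
rewrite mulrDl lerD// ler_wpM2l// ge0_ler_powR ?nnegrE//; lra.
Qed.

Lemma perspective_powR_subadd (R : realType) (p x y s t : R) : 1 <= p ->
  0 <= x -> 0 <= y -> 0 < s -> 0 < t ->
  (x + y) `^ p / (s + t) `^ (p - 1)
    <= x `^ p / s `^ (p - 1) + y `^ p / t `^ (p - 1).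
Proof.
move=> p1 x0 y0 s0 t0.
have E (a r : R) : 0 <= a -> 0 < r -> a `^ p / r `^ (p - 1) = r * (a / r) `^ p.
  move=> a0 r0; rewrite powRM ?invr_ge0 ?(ltW r0)//.
  rewrite -(mulr_powRB1 (x := r^-1)) ?invr_ge0 ?(ltW r0)//; last lra.
  have -> : r^-1 `^ (p - 1) = (r `^ (p - 1))^-1.
    by rewrite -(powR_inv1 (ltW r0)) powRAC powR_inv1 ?powR_ge0.
  by field; rewrite !gt_eqF ?powR_gt0.
rewrite !E ?addr_ge0 ?addr_gt0//.
have st0 : 0 < s + t by lra.
have l0 : 0 <= s / (s + t) by rewrite divr_ge0//; lra.
have l1 : s / (s + t) <= 1 by rewrite ler_pdivrMr//; lra.
have := convex_powR p1 (Itv01 l0 l1) (x := x / s) (y := y / t).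
rewrite !inE/= !in_itv/= !andbT !convRE/= [X in X `^ _ <= _]convRE/= /unstable.onem.
move=> /(_ (divr_ge0 x0 (ltW s0)) (divr_ge0 y0 (ltW t0))).
have -> : s / (s + t) * (x / s) + (1 - s / (s + t)) * (y / t) = (x + y) / (s + t).
  by field; rewrite !gt_eqF.
move=> /(ler_wpM2l (ltW st0)) /le_trans; apply.
rewrite le_eqVlt; apply/orP; left; apply/eqP.
by field; rewrite !gt_eqF.
Qed.

Lemma picone (R : realType) (p x y s t : R) : 1 < p ->
  0 <= x -> 0 <= y -> 0 < s -> 0 < t ->
  signed_pow p (s - t) * (x `^ p / s `^ (p - 1) - y `^ p / t `^ (p - 1))
    <= `|x - y| `^ p.
Proof.
move=> p1; wlog st : x y s t / t <= s.
  move=> H x0 y0 s0 t0; have [ts|st] := leP t s; first exact: H.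
  have := H y x t s (ltW st) y0 x0 t0 s0.
  by rewrite -(opprB s t) signed_powN distrC mulNr -mulrN opprB.
move=> x0 y0 s0 t0; have [<-|ts] := eqVneq s t.
  by rewrite subrr signed_pow0 mul0r powR_ge0.
have d0 : 0 < s - t by rewrite subr_gt0 lt_neqAle st eq_sym ts.
rewrite signed_pow_gt0E// mulrC -ler_pdivlMr ?powR_gt0// lerBlDl.
have [xy|xy] := leP x y.
  apply: (@le_trans _ _ (y `^ p / t `^ (p - 1))).
    apply: ler_pM; rewrite ?invr_ge0 ?powR_ge0//.
      by rewrite ge0_ler_powR ?nnegrE//; lra.
    by rewrite lef_pV2 ?posrE ?powR_gt0// ge0_ler_powR ?nnegrE//; lra.
  by rewrite lerDl divr_ge0 ?powR_ge0.
have xy0 : 0 <= x - y by lra.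
have := perspective_powR_subadd (ltW p1) y0 xy0 t0 d0.
by rewrite (ger0_norm xy0) ![_ + (_ - _)]addrC !subrK.
Qed.


(** Picone's inequality with [t = y], extended to [y = 0], where it is an equality. It serves the
    edges on which only one endpoint is cut off by [u]. *)
Lemma picone_diag (R : realType) (p x y s : R) : 1 < p ->
  0 <= x -> 0 <= y -> 0 < s ->
  signed_pow p (s - y) * (x `^ p / s `^ (p - 1) - y) <= `|x - y| `^ p.
Proof.
move=> p1 x0 y0 s0; have p0 : 0 < p by lra.
move: y0; rewrite le_eqVlt => /predU1P[<-|y0].
  rewrite !subr0 signed_pow_gt0E// (ger0_norm x0) mulrC divfK//.
  by rewrite gt_eqF ?powR_gt0.
have := picone p1 x0 (ltW y0) s0 y0.
by rewrite -(mulr_powRB1 (ltW y0) p0) mulfK// gt_eqF ?powR_gt0.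
Qed.

(** * Edge inequalities for the two truncations *)

Lemma edge_max0 (R : realType) (p x y s t : R) : 1 < p -> 0 < s -> 0 < t ->
  `|Num.max 0 x - Num.max 0 y| `^ p
    + signed_pow p (s - t) * ((`|x| `^ p - Num.max 0 x `^ p) / s `^ (p - 1)
                              - (`|y| `^ p - Num.max 0 y `^ p) / t `^ (p - 1))
  <= `|x - y| `^ p.
Proof.
move=> p1; wlog xy : x y s t / y <= x.
  move=> H s0 t0; have [yx|xy] := leP y x; first exact: H.
  have := H y x t s (ltW xy) t0 s0.
  rewrite -(opprB s t) signed_powN distrC (distrC y).
  by rewrite mulNr -mulrN opprB.
move=> s0 t0; have [y0|y0] := leP 0 y.
  have x0 : 0 <= x by lra.
  by rewrite (max_r x0) (ger0_norm x0) (ger0_norm y0) !subrr !mul0r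
    subrr mulr0 addr0.
have p0 : p != 0 by lra.
rewrite powR0// !subr0 (ltr0_norm y0); have [x0|x0] := leP 0 x.
  rewrite (ger0_norm x0) subrr mul0r sub0r.
  rewrite (@ger0_norm _ (x - y)); last lra.
  (* Opposite signs: superadditivity splits off [(- y)]^ p[, which absorbs the cross term because]t
     - s <= t[gives]signed_pow p (t - s) <= t [^ (p - 1)]. *)
  apply: le_trans (powR_superadd (y := - y) (ltW p1) x0 _); last lra.
  rewrite lerD2l mulrN -mulNr -signed_powN opprB mulrA ler_pdivrMr ?powR_gt0//.
  rewrite mulrC ler_wpM2l ?powR_ge0// -signed_pow_gt0E// signed_pow_le//; lra.
(* Both values are negative, so both truncations vanish and Picone's inequality for [- x] and [- y]
   remains. *)
rewrite (ltr0_norm x0) powR0// subr0 normr0 powR0// add0r.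
have -> : x - y = - y - - x by ring.
by rewrite distrC picone//; lra.
Qed.

Lemma edge_min (R : realType) (p x y s t : R) : 1 < p ->
  0 <= x -> 0 <= y -> 0 < s -> 0 < t ->
  `|Num.min x s - Num.min y t| `^ p
    + signed_pow p (s - t) * ((x `^ p - Num.min x s `^ p) / s `^ (p - 1)
                              - (y `^ p - Num.min y t `^ p) / t `^ (p - 1))
  <= `|x - y| `^ p.
Proof.
(* Up to exchanging the endpoints, the case where only [y] is cut off does not occur. *)
move=> p1; wlog xy : x y s t / (x <= s -> y <= t).
  move=> H x0 y0 s0 t0; case: (boolP (y <= t)) => [yt|nyt].
    exact: H (fun=> yt) x0 y0 s0 t0.
  have := H y x t s; rewrite (negbTE nyt) => /(_ ltac:(by []) y0 x0 t0 s0).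
  rewrite -(opprB s t) signed_powN distrC (distrC y).
  by rewrite mulNr -mulrN opprB.
move=> x0 y0 s0 t0; have p0 : 0 < p by lra.
have div (r : R) : 0 < r -> r `^ p / r `^ (p - 1) = r.
  by move=> r0; rewrite -(mulr_powRB1 (ltW r0) p0) mulfK// gt_eqF ?powR_gt0.
have [xs|sx] := leP x s.
  by rewrite !min_l ?xy// !subrr !mul0r subrr mulr0 addr0.
have [yt|ty] := leP y t.
  (* Only [x] is cut off. As [y <= t], monotonicity replaces [s - t] by [s - y] in front of the
     nonnegative factor [x]^ p / s [^ (p - 1) - s]. *)
  apply: le_trans (picone_diag p1 x0 y0 s0).
  rewrite subrr mul0r subr0 mulrBl div// -(@signed_powM _ _ (s - y))//.
  have xs : 0 <= x `^ p / s `^ (p - 1) - s.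
    rewrite subr_ge0 -{1}(div s s0) ler_wpM2r ?invr_ge0 ?powR_ge0//.
    by rewrite ge0_ler_powR ?nnegrE//; lra.
  have : signed_pow p (s - t) <= signed_pow p (s - y).
    by apply: signed_pow_le => //; lra.
  by nra.
(* Both values are cut off: [|s - t|^p] cancels against the part [signed_pow p (s - t) * (t - s)] of
   the cross term. *)
rewrite !mulrBl !div// -signed_powM//.
apply: le_trans (picone p1 x0 y0 s0 t0).
by rewrite le_eqVlt; apply/orP; left; apply/eqP; ring.
Qed.

Definition truncate (R : realType) (x s : R) : R := Num.min (Num.max 0 x) s.

(* The test function in which the supersolution inequality is used. *)
Definition defect (R : realType) (p x s : R) : R :=
  (`|x| `^ p - truncate x s `^ p) / s `^ (p - 1).

Lemma truncate_ge0 (R : realType) (x s : R) : 0 < s -> 0 <= truncate x s.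
Proof. by move=> s0; rewrite le_min le_max lexx (ltW s0). Qed.

Lemma defect_ge0 (R : realType) (p x s : R) : 1 < p -> 0 < s ->
  0 <= defect p x s.
Proof.
move=> p1 s0; rewrite divr_ge0 ?powR_ge0// subr_ge0 ge0_ler_powR ?nnegrE//.
- lra.
- exact: truncate_ge0.
- by rewrite ge_min ge_max normr_ge0 ler_norm.
Qed.

(** The two edge inequalities chain: [defect] is the sum of their weights, in which the powers of
    [Num.max 0 x] cancel. *)
Lemma edge_truncate (R : realType) (p x y s t : R) : 1 < p -> 0 < s -> 0 < t ->
  `|truncate x s - truncate y t| `^ p
    + signed_pow p (s - t) * (defect p x s - defect p y t)
  <= `|x - y| `^ p.
Proof.
move=> p1 s0 t0; apply: le_trans (edge_max0 x y p1 s0 t0).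
have m0 (z : R) : 0 <= Num.max 0 z by rewrite le_max lexx.
apply: le_trans (lerD (edge_min p1 (m0 x) (m0 y) s0 t0) (lexx _)).
rewrite le_eqVlt; apply/orP; left; apply/eqP.
by rewrite /defect /truncate; field; rewrite !gt_eqF ?powR_gt0.
Qed.

(** * Sums over pairs and comparison of energies *)

Lemma esum_pZl (R : realType) (T : choiceType) (I : set T) (r : R)
    (a : T -> \bar R) : 0 <= r -> (forall i, 0 <= a i)%E ->
  (\esum_(i in I) (r%:E * a i) = r%:E * \esum_(i in I) a i)%E.
Proof.
move=> r0 a0; rewrite /esum -ereal_supZl//.
  congr ereal_sup; rewrite image_comp; apply: eq_imagel => A _ /=.
  by rewrite ge0_mule_fsumr.
apply/set0P; exists (\sum_(x \in set0) a x)%E; exists set0 => //.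
exact: fsets_set0.
Qed.

(** Summing row by row, the weight leaves each finite row sum and rows outside [F] vanish. This
    links the pointwise inequality for [u], tested against [w], to sums over edges. *)
Lemma esum_weighted_rows (R : realType) (X Y : choiceType) (F : set X)
    (w : X -> R) (k : X -> Y -> R) :
  finite_set F -> (forall x, ~ F x -> w x = 0) -> (forall x, 0 <= w x) ->
  (forall x y, 0 <= k x y) ->
  (forall x, \esum_(y in [set: Y]) (k x y)%:E < +oo)%E ->
  (\esum_(xy in [set: X * Y]) (w xy.1 * k xy.1 xy.2)%:E
   = (\sum_(x \in F) w x * fine (\esum_(y in [set: Y]) (k x y)%:E))%:E)%E.
Proof.
move=> finF w0 wge0 kge0 kfin.
have rowE x : (\esum_(y in [set: Y]) (w x * k x y)%:E
    = (w x * fine (\esum_(y in [set: Y]) (k x y)%:E))%:E)%E.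
  under eq_esum do rewrite EFinM.
  rewrite esum_pZl//; last by move=> y; rewrite lee_fin.
  rewrite EFinM fineK// ge0_fin_numE//.
  by apply: esum_ge0 => y _; rewrite lee_fin.
have -> : [set: X * Y] = [set: X] `*`` (fun=> [set: Y]) by apply/seteqP; split.
rewrite -(esum_esum (a := fun x y => (w x * k x y)%:E)); last first.
  by move=> x y _ _; rewrite lee_fin mulr_ge0.
under eq_esum do rewrite rowE.
rewrite -fsumEFin// -esum_fset//; last first.
  move=> x _; rewrite lee_fin mulr_ge0// fine_ge0// esum_ge0// => y _.
  by rewrite lee_fin.
rewrite [RHS]esum_mkcond; apply: eq_esum => x _.
by case: ifPn => // /negP; rewrite inE => /w0 ->; rewrite mul0r.
Qed.

Lemma energy_le (R : realType) (X : countType) (p : R) (m : X -> R)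
    (b : X -> X -> R) (c u phi psi w : X -> R) (F : set X) :
  1 < p -> (forall x, 0 < m x) -> (forall x y, 0 <= b x y) ->
  (forall x y, b x y = b y x) -> (forall x, 0 < u x) ->
  supersolution p m b c u ->
  finite_set F -> (forall x, ~ F x -> phi x = 0) ->
  (forall x, ~ F x -> psi x = 0) ->
  (forall x, ~ F x -> w x = 0) -> (forall x, 0 <= w x) ->
  (forall x, w x * u x `^ (p - 1) = `|phi x| `^ p - `|psi x| `^ p) ->
  (forall x y, `|psi x - psi y| `^ p
     + signed_pow p (u x - u y) * (w x - w y) <= `|phi x - phi y| `^ p) ->
  (energy p b c psi <= energy p b c phi)%E.
Proof.
move=> p1 m0 b0 bsym u0 [udom usup] finF phi0 psi0 w0 wge0 wu edge.
(* The flow of [u] is antisymmetric. Its positive and negative parts are kept apart, so that only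
   nonnegative families are summed; reversing an edge exchanges them. *)
pose a x y := b x y * signed_pow p (u x - u y).
pose ap x y := Num.max (a x y) 0.
pose an x y := Num.max (- a x y) 0.
have aN x y : a y x = - a x y.
  by rewrite /a bsym -(opprB (u x)) signed_powN mulrN.
have anE x y : an x y = ap y x by rewrite /an /ap (aN x y).
have aE x y : a x y = ap x y - an x y.
  rewrite /ap /an; have [h|h] := leP (a x y) 0.
    by rewrite max_l ?oppr_ge0//; ring.
  by rewrite max_r ?oppr_le0 ?(ltW h)//; ring.
have ap0 x y : 0 <= ap x y by rewrite le_max lexx orbT.
have an0 x y : 0 <= an x y by rewrite le_max lexx orbT.
have normaE x y : `|a x y| = b x y * `|u x - u y| `^ (p - 1).
  by rewrite normrM (ger0_norm (b0 _ _)) norm_signed_pow.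
have apfin x : (\esum_(y in [set: X]) (ap x y)%:E < +oo)%E.
  apply: le_lt_trans (udom x); apply: le_esum => y _.
  by rewrite lee_fin -normaE ge_max normr_ge0 ler_norm.
have anfin x : (\esum_(y in [set: X]) (an x y)%:E < +oo)%E.
  apply: le_lt_trans (udom x); apply: le_esum => y _.
  by rewrite lee_fin -normaE ge_max normr_ge0 -normrN ler_norm.
have := esum_weighted_rows finF w0 wge0 ap0 apfin.
have := esum_weighted_rows finF w0 wge0 an0 anfin.
set N := \sum_(x \in F) _; set P := \sum_(x \in F) _ => NE PE.
have swapE (f : X * X -> \bar R) :
    (\esum_(z in [set: X * X]) f z = \esum_(z in [set: X * X]) f (z.2, z.1))%E.
  apply: (@reindex_esum _ _ _ setT setT (fun z : X * X => (z.2, z.1))).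
  by split => // [[x y] [x' y'] _ _ [-> ->]//|[x y] _]; exists (y, x).
pose E (f : X -> R) := (\esum_(z in [set: X * X])
    (b z.1 z.2 * `|f z.1 - f z.2| `^ p)%:E)%E.
have E0 f : (0 <= E f)%E.
  by apply: esum_ge0 => z _; rewrite lee_fin mulr_ge0 ?powR_ge0.
(* The edge inequality summed over ordered pairs, with the negative parts moved to the right so that
   no infinite value is subtracted. *)
have flow : (E psi + (P%:E + P%:E) <= E phi + (N%:E + N%:E))%E.
  have wap0 x y z : (0 <= (w x * ap y z)%:E)%E by rewrite lee_fin mulr_ge0.
  have wan0 x y z : (0 <= (w x * an y z)%:E)%E by rewrite lee_fin mulr_ge0.
  have b0' f x y : (0 <= (b x y * `|f x - f y| `^ p)%:E :> \bar R)%E.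
    by rewrite lee_fin mulr_ge0 ?powR_ge0.
  rewrite -{1}PE -{1}NE -PE -NE.
  (* Reversing the pairs in one copy of each double sum makes every edge carry both [w x] and [w y],
     which together yield [a x y * (w x - w y)]. *)
  rewrite {2}swapE/= [X in (_ <= _ + (_ + X))%E]swapE/=.
  rewrite -!esumD//=; try by move=> z _; rewrite ?adde_ge0.
  apply: le_esum => -[x y] _ /=; rewrite -!EFinD lee_fin.
  have := ler_wpM2l (b0 x y) (edge x y).
  rewrite mulrDr [X in _ + X <= _]mulrA -/(a x y) mulrBr {1}aE.
  have -> : a x y = - (ap y x - an y x) by rewrite -aE -aN.
  lra.
have potE (f : X -> R) : (forall x, ~ F x -> f x = 0) ->
    \sum_(x \in [set: X]) c x * `|f x| `^ p
    = \sum_(x \in F) c x * `|f x| `^ p.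
  move=> f0; apply/esym/fsbig_widen => //.
  by move=> x [_ /f0 /= ->]; rewrite normr0 powR0 ?mulr0//; lra.
rewrite /energy !potE// -/(E psi) -/(E phi).
set S' := \sum_(x \in F) c x * `|psi x| `^ p.
set S := \sum_(x \in F) c x * `|phi x| `^ p.
(* The supersolution inequality at [x], multiplied by [m x * w x] and summed over [F]; [wu] turns
   the potential term into a difference of [p]-th powers. *)
have sup : 0 <= P - N + (S - S').
  rewrite /P /N /S /S' !fsbig_finite// -!sumrB -big_split/= sumr_ge0// => x _.
  have := usup x; rewrite /schroedinger signed_pow_gt0E//.
  move=> /(mulr_ge0 (ltW (m0 x))) /(mulr_ge0 (wge0 x)).
  rewrite mulrDr mulrA divff ?gt_eqF// mul1r.
  have -> : m x * (c x / m x * u x `^ (p - 1)) = c x * u x `^ (p - 1).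
    by field; rewrite gt_eqF.
  rewrite mulrDr mulrCA wu /abs_sum -/(a x) mulrBr mulrBr.
  exact.
(* An infinite [E phi] makes the claim trivial; a finite one forces [E psi] to be finite, and half
   of [flow] combines with [sup]. *)
move: flow (E0 psi) (E0 phi); case: (E phi) => [r| |]//; last first.
  by move=> *; rewrite gt0_muley ?lte_fin ?invr_gt0// addye// leey.
case: (E psi) => [r'| |]//=; rewrite -!EFinD !lee_fin => flow _ _.
by lra.
Qed.

Unset Implicit Arguments.
Set Strict Implicit.

Theorem lemma2p5 (R : realType) (p : R) (hp : 1 < p) :
  exists C : R, 0 < C /\
    forall (X : countType) (m : X -> R) (b : X -> X -> R) (c : X -> R),
      infinite_set [set: X] ->
      (forall x, 0 < m x) ->
      connected_graph b ->
      (forall phi : X -> R, finitely_supported phi -> (0 <= energy p b c phi)%E) ->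
      forall u : X -> R,
        (forall x, 0 < u x) -> supersolution p m b c u ->
        forall phi : X -> R, finitely_supported phi ->
          (energy p b c (fun x => Num.min (Num.max 0 (phi x)) (u x))%R
             <= C%:E * energy p b c phi)%E.
Proof.
exists 1; split=> // X m b c _ m0 [b0 bsym _ _ _] _ u u0 usup phi finphi.
rewrite mul1e.
have trunc0 s : 0 < s -> truncate (0 : R) s = 0.
  by move=> s0; rewrite /truncate max_l// min_l// ltW.
have phi0 x : ~ [set x | phi x != 0] x -> phi x = 0.
  by move=> /negP; rewrite negbK => /eqP.
(* The support of [phi] serves as [F]: where [phi] vanishes, so do its truncation and the defect. *)
apply: (energy_le (w := fun x => defect p (phi x) (u x)) hp m0 b0 bsym u0 usup
  finphi phi0) => [x /phi0 ->|x /phi0 ->|x|x|x y].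
- exact: trunc0.
- by rewrite /defect trunc0// normr0 subrr mul0r.
- exact: defect_ge0.
- by rewrite /defect divfK ?gt_eqF ?powR_gt0// (ger0_norm (truncate_ge0 _ _)).
- exact: edge_truncate.
Qed.
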